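(* The Čech–Stone compactification $\beta^*\mathbb N=(\beta\mathbb N,\delta_{\beta\mathbb N})$ of the approach space $(\mathbb N,\delta_{d_{\mathbb E}})$ is a normal approach space.
   Context: A distance on a set $X$ is a function $\delta:X\times 2^X\to[0,\infty]$ such that for all $x\in X$, $A,B\subseteq X$, $\varepsilon\in[0,\infty]$: (D1) $\delta(x,\{x\})=0$; (D2) $\delta(x,\emptyset)=\infty$; (D3) $\delta(x,A\cup B)=\min\{\delta(x,A),\delta(x,B)\}$; (D4) $\delta(x,A)\le\delta(x,A^{(\varepsilon)})+\varepsilon$, where $A^{(\varepsilon)}=\{x\in X\mid\delta(x,A)\le\varepsilon\}$. The pair $(X,\delta)$ is an approach space. For a real $\gamma>0$, sets $A,B\subseteq X$ are $\gamma$-separated if $A^{(\alpha)}\cap B^{(\beta)}=\emptyset$ whenever $\alpha\ge0$, $\beta\ge0$ and $\alpha+\beta<\gamma$. A contractive scale is a map $F:\mathbb Q\to 2^X$ with $\bigcup_{q\in\mathbb Q}F(q)=X$ and $\bigcap_{q\in\mathbb Q}F(q)=\emptyset$ such that for all rationals $r<s$ the sets $F(r)$ and $X\setminus F(s)$ are $(s-r)$-separated. $(X,\delta)$ is normal if for all $A,B\subseteq X$ and all real $\gamma>0$ with $A$ and $B$ $\gamma$-separated, there exists a contractive scale $F$ such that (i) $F(q)=\emptyset$ for all rational $q<0$; (ii) $A\subseteq\bigcap_{q\in\mathbb Q,\,q\ge0}F(q)$; (iii) $B\cap\bigcup_{r\in\mathbb Q\cap\,]0,\gamma]}F(r)=\emptyset$.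 $\mathbb N$ carries the Euclidean metric $d_{\mathbb E}(m,n)=|m-n|$ with associated distance $\delta_{d_{\mathbb E}}(n,F)=\inf_{m\in F}|n-m|$, and $F^{(\alpha)_{d_{\mathbb E}}}=\{n\in\mathbb N\mid\delta_{d_{\mathbb E}}(n,F)\le\alpha\}$ for $F\subseteq\mathbb N$. $\beta\mathbb N$ is the set of all ultrafilters on $\mathbb N$. For $\mathcal A\subseteq\beta\mathbb N$ let $\mathcal F_{\mathcal A}=\bigcap_{q\in\mathcal A}q$ (the collection of subsets of $\mathbb N$ belonging to every $q\in\mathcal A$; for $\mathcal A=\emptyset$ this is the full power set of $\mathbb N$). The distance of the Čech–Stone compactification is $$\delta_{\beta\mathbb N}(p,\mathcal A)=\sup_{F\in\mathcal F_{\mathcal A}}\inf\{\alpha\ge0\mid F^{(\alpha)_{d_{\mathbb E}}}\in p\}$$ for $p\in\beta\mathbb N$, $\mathcal A\subseteq\beta\mathbb N$ (with $\inf\emptyset=\infty$). *)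

(* Defs.v *)
From HB Require Import structures.
From mathcomp Require Import all_boot all_order all_algebra.
From mathcomp Require Import all_classical all_reals ereal.

Set Implicit Arguments.
Unset Strict Implicit.
Unset Printing Implicit Defensive.

Import Order.TTheory GRing.Theory Num.Theory.

Local Open Scope classical_set_scope.
Local Open Scope ring_scope.

Section ApproachSpaces.
Context {R : realType} {X : Type}.
Implicit Types (delta : X -> set X -> \bar R) (A B : set X).

(* Written A^(e) in approach theory. *)
Definition enlarge delta A (e : \bar R) : set X :=
  [set x | (delta x A <= e)%E].

Definition is_distance delta : Prop :=
  [/\ forall x A, (0 <= delta x A)%E,
      forall x, delta x [set x] = 0%E,
      forall x, delta x set0 = +oo%E,
      forall x A B, delta x (A `|` B) = mine (delta x A) (delta x B)
    & forall x A (e : \bar R), (0 <= e)%E ->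
        (delta x A <= delta x (enlarge delta A e) + e)%E].

Definition separated_by delta (gamma : R) A B : Prop :=
  forall a b : R, 0 <= a -> 0 <= b -> a + b < gamma ->
    enlarge delta A a%:E `&` enlarge delta B b%:E = set0.

Definition contractive_scale delta (F : rat -> set X) : Prop :=
  [/\ \bigcup_q F q = setT,
      \bigcap_q F q = set0
    & forall r s : rat, r < s ->
        separated_by delta (ratr (s - r)) (F r) (~` F s)].

Definition normal_distance delta : Prop :=
  forall A B (gamma : R), 0 < gamma -> separated_by delta gamma A B ->
    exists F : rat -> set X,
      [/\ contractive_scale delta F,
          forall q : rat, q < 0 -> F q = set0,
          A `<=` \bigcap_(q in [set q : rat | 0 <= q]) F q
        & B `&` \bigcup_(r in [set r : rat | 0 < r /\ ratr r <= gamma]) F r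
            = set0].

Definition normal_approach_space delta : Prop :=
  is_distance delta /\ normal_distance delta.

End ApproachSpaces.

Section CechStoneN.
Context {R : realType}.

Definition dE (m n : nat) : R := `|m%:R - n%:R|.

(* ereal_inf set0 = +oo, so every point is at distance +oo from set0. *)
Definition delta_dE (n : nat) (F : set nat) : \bar R :=
  ereal_inf [set (dE n m)%:E | m in F].

Record betaN : Type := BetaN {
  ultra_sets : set_system nat;
  ultra_setsP : UltraFilter ultra_sets }.

(* The intersection of the ultrafilters in A; all subsets of nat if A is
   empty. *)
Definition filter_of (A : set betaN) : set_system nat :=
  [set F | forall q : betaN, A q -> ultra_sets q F].

Definition delta_betaN (p : betaN) (A : set betaN) : \bar R :=
  ereal_sup [set ereal_inf [set a%:E | a in
                   [set a : R | 0 <= a /\ ultra_sets p (enlarge delta_dE F a%:E)]]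
            | F in filter_of A].

End CechStoneN.

(* Main.v *)
Require Import Defs.
From mathcomp Require Import all_boot all_order all_algebra.
From mathcomp Require Import all_classical all_reals ereal.
From mathcomp Require Import lra.

Set Implicit Arguments.
Unset Strict Implicit.
Unset Printing Implicit Defensive.

Import Order.TTheory GRing.Theory Num.Theory.

Local Open Scope classical_set_scope.
Local Open Scope ring_scope.

(** The metric of [nat] takes integer values, so every threshold [a] for
[delta_dE] may be replaced by the natural number [truncn a], and the distance
of the compactification becomes a statement about ultrafilters: by
[delta_betaN_le],
  [delta_betaN p A <= a] iff [p] contains the [truncn a]-neighbourhood of every
  set [F] that belongs to all the ultrafilters in [A].
The axioms of a distance then follow from the algebra of the neighbourhoods
[thicken F k], from the primality of ultrafilters (for binary unions) and from
[truncn a + truncn b <= truncn (a + b)] (for the triangle inequality).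

For normality, let [A] and [B] be [gamma]-separated and let [k] be the largest
natural number below [gamma].  The [k]-enlargement of [A] does not meet the
closure of [B].  By compactness, that is, by the existence of ultrafilters
finer than a given filter, this is already visible on [nat]
([disjoint_sets_of_separated]): some [F] in all ultrafilters of [A] and some
[G] in all ultrafilters of [B] satisfy [thicken F k `&` G = set0], which
says that all points of [G] are at distance at least [gamma] from [F].
The distance to [F] is a nonexpansive function on [nat]; its sublevel sets,
transported to ultrafilters and cut off at [0] and [gamma], form the scale
[scale F gamma].  It is contractive ([scale_separated]) because an ultrafilter
close to both [scale F gamma r] and the complement of [scale F gamma s]
provides an actual natural number close to both sublevel sets, hence two
naturals that are closer to each other than the difference between their
distances to [F]. *)

Local Existing Instance ultra_setsP.

(** * Integer neighbourhoods of sets of naturals *)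

Definition thicken (F : set nat) (k : nat) : set nat :=
  [set m | exists2 x, F x & (`|m - x|%N <= k)%N].

Lemma thickenS F k l : (k <= l)%N -> thicken F k `<=` thicken F l.
Proof. by move=> kl m [x Fx mx]; exists x => //; apply: leq_trans kl. Qed.

Lemma subset_thicken F G k : F `<=` G -> thicken F k `<=` thicken G k.
Proof. by move=> FG m [x Fx mx]; exists x => //; apply: FG. Qed.

Lemma thicken_id F k : F `<=` thicken F k.
Proof. by move=> m Fm; exists m; rewrite // distnn. Qed.

Lemma thicken_thicken F k l :
  thicken (thicken F k) l `<=` thicken F (k + l)%N.
Proof.
move=> m [y [x Fx yx] my]; exists x => //.
by rewrite (leq_trans (leqD_dist _ y _))// addnC leq_add.
Qed.

Lemma thicken0 k : thicken set0 k = set0.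
Proof. by rewrite -subset0 => m []. Qed.

Lemma thickenU F G k : thicken (F `|` G) k = thicken F k `|` thicken G k.
Proof.
apply/seteqP; split=> m; last first.
  by case; apply: subset_thicken => x; [left|right].
by case=> x [Fx|Gx] mx; [left|right]; exists x.
Qed.

Lemma ultra_setU (p : betaN) F G :
  ultra_sets p (F `|` G) -> ultra_sets p F \/ ultra_sets p G.
Proof.
move=> FG; have [|nF] := in_ultra_setVsetC F (ultra_setsP p); first by left.
right; apply: filterS (filterI FG nF) => x [[]//].
Qed.

(** * Distances as statements about ultrafilters *)

Section Distances.
Context {R : realType}.
Implicit Types (p : betaN) (A B : set betaN) (F G : set nat) (a : R).

(** An infimum of integers that is at most [a] is below [(truncn a).+1], hence
one of these integers is at most [truncn a]. *)
Lemma enlarge_dE F a : 0 <= a ->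
  enlarge delta_dE F a%:E = thicken F (Num.truncn a).
Proof.
have dEE m x : dE m x = (`|m - x|%N)%:R :> R.
  by rewrite /dE [RHS]pmulrn abszE intr_norm rmorphB.
move=> a0; apply/seteqP; split=> m; rewrite /enlarge /delta_dE /=; last first.
  move=> [x Fx mx]; apply: ge_ereal_inf; exists (dE m x)%:E; first by exists x.
  by rewrite lee_fin dEE -truncn_ge_nat.
move=> h; have /ereal_inf_lt : (ereal_inf [set (dE m x)%:E | x in F] <
    ((Num.truncn a).+1%:R : R)%:E)%E.
  by apply: le_lt_trans h _; rewrite lte_fin truncnS_gt.
move=> [_ [x Fx <-]]; rewrite lte_fin dEE ltr_nat ltnS => mx.
by exists x.
Qed.

(** The integrality is used a second time here: the infimum over the radii
need not be attained a priori, but all radii with the same integer part give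
the same neighbourhood. *)
Lemma delta_betaN_le p A a : 0 <= a ->
  (delta_betaN p A <= a%:E)%E <->
  forall F, filter_of A F -> ultra_sets p (thicken F (Num.truncn a)).
Proof.
move=> a0; split=> [h F AF|h]; last first.
  apply: ge_ereal_sup => _ [F AF <-]; apply: ge_ereal_inf; exists a%:E => //.
  by exists a => //; split=> //; rewrite enlarge_dE//; apply: h.
have /ereal_inf_lt : (ereal_inf [set b%:E | b in
    [set b : R | (0 <= b)%R /\ ultra_sets p (enlarge delta_dE F b%:E)]] <
    ((Num.truncn a).+1%:R : R)%:E)%E.
  apply: (@le_lt_trans _ _ a%:E); last by rewrite lte_fin truncnS_gt.
  by apply: le_trans h; apply: ereal_sup_ubound; exists F.
move=> [_ [b [b0 pb] <-]]; rewrite lte_fin -truncn_lt_nat// ltnS => ba.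
by rewrite enlarge_dE// in pb; apply: filterS pb; apply: thickenS.
Qed.

Lemma delta_betaN_ge0 p A : (0 <= delta_betaN p A :> \bar R)%E.
Proof.
apply: (@le_trans _ _ (ereal_inf [set b%:E | b in
    [set b : R | (0 <= b)%R /\ ultra_sets p (enlarge delta_dE setT b%:E)]])).
  by apply: le_ereal_inf_tmp => _ [b [b0 _] <-]; rewrite lee_fin.
apply: ereal_sup_ubound; exists setT => // q _; exact: filterT.
Qed.

Lemma delta_betaN0 p : delta_betaN p set0 = +oo%E :> \bar R.
Proof.
case E : (delta_betaN p set0) (delta_betaN_ge0 p set0) => [a| |]//.
rewrite lee_fin => a0.
have /delta_betaN_le : (delta_betaN p set0 <= a%:E)%E by rewrite E.
move=> /(_ a0 set0); rewrite thicken0 => h; exfalso.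
by apply: (@filter_not_empty _ (ultra_sets p)); apply: h.
Qed.

Lemma delta_betaNU p A B : delta_betaN p (A `|` B) =
  mine (delta_betaN p A) (delta_betaN p B) :> \bar R.
Proof.
have mono C D : C `<=` D -> (delta_betaN p D <= delta_betaN p C :> \bar R)%E.
  move=> CD; apply: ereal_sup_le => _ [F DF <-]; exists F => // q Cq.
  exact/DF/CD.
apply/eqP; rewrite eq_le; apply/andP; split.
  by rewrite le_min (mono _ _ (@subsetUl _ A B)) (mono _ _ (@subsetUr _ A B)).
case E : (delta_betaN p (A `|` B)) (delta_betaN_ge0 p (A `|` B)) => [a| |]//;
  last by move=> _; exact: leey.
rewrite lee_fin => a0; rewrite ge_min.
have /delta_betaN_le : (delta_betaN p (A `|` B) <= a%:E)%E by rewrite E.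
move=> /(_ a0) h; apply/orP; apply: contrapT => /not_orP[].
move=> /(delta_betaN_le p A a0)/existsNP[F /not_implyP[AF nF]].
move=> /(delta_betaN_le p B a0)/existsNP[G /not_implyP[BG nG]].
have /h : filter_of (A `|` B) (F `|` G).
  by move=> q [/AF|/BG]; apply: filterS => x; [left|right].
by rewrite thickenU => /ultra_setU[].
Qed.

Lemma delta_betaN_triangle p A (e : \bar R) : (0 <= e)%E ->
  (delta_betaN p A <= delta_betaN p (enlarge delta_betaN A e) + e)%E.
Proof.
case: e => [e| |]// e0; last first.
  have := delta_betaN_ge0 p (enlarge (@delta_betaN R) A +oo%E).
  by case: (delta_betaN p (enlarge _ _ _)) => // *; rewrite leey.
case E : (delta_betaN p _) (delta_betaN_ge0 p (enlarge delta_betaN A e%:E))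
  => [b| |]//; last by move=> _; rewrite addye// leey.
rewrite lee_fin in e0; rewrite lee_fin => b0.
have /(delta_betaN_le _ _ b0) h :
  (delta_betaN p (enlarge delta_betaN A e%:E) <= b%:E)%E by rewrite E.
rewrite -EFinD; apply/delta_betaN_le; first exact: addr_ge0.
move=> F AF; have /h : filter_of (enlarge delta_betaN A e%:E)
    (thicken F (Num.truncn e)).
  by move=> q /(delta_betaN_le _ _ e0); apply.
apply: filterS; apply: subset_trans (@thicken_thicken _ _ _) _.
apply: thickenS; rewrite truncn_ge_nat ?addr_ge0// natrD addrC.
by rewrite lerD ?truncn_le.
Qed.

Lemma is_distance_betaN : is_distance (@delta_betaN R).
Proof.
split.
- exact: delta_betaN_ge0.
- move=> p; apply/eqP; rewrite eq_le delta_betaN_ge0 andbT.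
  apply/delta_betaN_le => // F /(_ p erefl).
  by apply: filterS; apply: thicken_id.
- exact: delta_betaN0.
- exact: delta_betaNU.
- exact: delta_betaN_triangle.
Qed.

(** * Compactness *)

(** If all the intersections [thicken F k `&` G] were nonempty, they would
form a filter base, and an ultrafilter containing all of them would be a common
point of the two enlargements. *)
Lemma disjoint_sets_of_separated A B k :
  enlarge delta_betaN A (k%:R : R)%:E `&` enlarge delta_betaN B (0 : R)%:E
    = set0 ->
  exists F G, [/\ filter_of A F, filter_of B G & thicken F k `&` G = set0].
Proof.
move=> AB0; apply: contrapT => noFG.
pose D : set (set nat * set nat) :=
  [set FG | filter_of A FG.1 /\ filter_of B FG.2].
pose base (FG : set nat * set nat) := thicken FG.1 k `&` FG.2.
have baseF : Filter (filter_from D base).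
  apply: filter_from_filter.
    by exists (setT, setT); split=> q _; apply: filterT.
  move=> [F G] [F' G'] [/= AF BG] [/= AF' BG'].
  exists (F `&` F', G `&` G').
    by split=> q hq /=; apply: filterI; [exact: AF|exact: AF'|exact: BG|
      exact: BG'].
  move=> m [/= FF'm [Gm G'm]]; split; split=> //=.
    by apply: subset_thicken FF'm => x [].
  by apply: subset_thicken FF'm => x [].
have baseP : ProperFilter (filter_from D base).
  apply: filter_from_proper => -[F G] [/= AF BG]; apply/set0P/eqP => FG0.
  by apply: noFG; exists F, G.
have [U [ultraU sU]] := ultraFilterLemma baseP.
have : set0 (BetaN ultraU); last by [].
rewrite -AB0; split; apply/delta_betaN_le => //= F hF.
- rewrite natrK; apply: sU; exists (F, setT) => /=.
    by split=> //= q _; apply: filterT.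
  by rewrite /base setIT.
- apply: filterS (@thicken_id _ _) _; apply: sU; exists (setT, F).
    by split=> //= q _; apply: filterT.
  by move=> m [].
Qed.

(** * The scale given by the distance to a set of naturals *)

(** The closure of [U] in the Stone space, where each natural is identified
with its principal ultrafilter. *)
Definition clopen (U : set nat) : set betaN := [set p | ultra_sets p U].

Lemma enlarge_clopen U a p : 0 <= a ->
  enlarge delta_betaN (clopen U) a%:E p ->
  ultra_sets p (thicken U (Num.truncn a)).
Proof. by move=> a0 /(delta_betaN_le _ _ a0); apply. Qed.

(** The points at distance [0] from [F] or at distance less than [q].  The
strict inequality keeps the sublevel [gamma] disjoint from points at distance
exactly [gamma]; the alternative [j = 0] keeps [F] inside the sublevel [0]. *)
Definition sublevel F (q : R) : set nat :=
  [set m | exists2 j : nat, j = 0%N \/ j%:R < q & thicken F j m].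

(** Taking everything beyond [gamma] makes the union of the scale the whole
space, even if [F] is empty, when all points are infinitely far from [F]. *)
Definition scale F (gamma : R) (q : rat) : set betaN :=
  if q < 0 then set0 else if gamma < ratr q then setT
  else clopen (sublevel F (ratr q)).

Lemma scale_separated F gamma (r s : rat) : r < s ->
  separated_by delta_betaN (ratr (s - r) : R)
    (scale F gamma r) (~` scale F gamma s).
Proof.
have empty0 p b : ~ enlarge delta_betaN set0 (b : R)%:E p.
  by rewrite /enlarge /= delta_betaN0.
move=> rs a b a0 b0 absr; rewrite -subset0 /scale => p [pA pB].
move: pA; case: ltP => [_ /empty0 //|r0].
move: pB; have -> : (s < 0) = false.
  by apply/negbTE; rewrite -leNgt (le_trans r0)// ltW.
case: ltP => [_|sg]; first by rewrite setCT => /empty0.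
have -> : (gamma < ratr r) = false.
  by apply/negbTE; rewrite -leNgt (le_trans _ sg)// ler_rat ltW.
have -> : ~` clopen (sublevel F (ratr s)) =
          clopen (~` sublevel F (ratr s)).
  apply/seteqP; split=> q /= hq.
    by have [] := in_ultra_setVsetC (sublevel F (ratr s)) (ultra_setsP q).
  move=> hq'; apply: (@filter_not_empty _ (ultra_sets q)).
  by apply: filterS (filterI hq hq') => x [].
move=> /(enlarge_clopen b0) pB /(enlarge_clopen a0) pA.
(* One natural [m] is close to [y] outside the level [s] and to [x] inside the
   level [r]; the triangle inequality then puts [y] inside the level [s]. *)
have [m [[y ny my] [x [j jr [z Fz xz]] mx]]] := filter_ex (filterI pB pA).
apply: ny; exists (j + Num.truncn a + Num.truncn b)%N; last first.
  exists z => //; rewrite (leq_trans (leqD_dist _ x _))// -addnA addnC.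
  rewrite leq_add//.
  by rewrite (leq_trans (leqD_dist _ m _))// addnC leq_add// distnC.
right; rewrite !natrD; move: absr; rewrite raddfB /=.
have : (Num.truncn a)%:R <= a by rewrite truncn_le.
have : (Num.truncn b)%:R <= b by rewrite truncn_le.
have : (j%:R : R) <= ratr r.
  by case: jr => [->|/ltW//]; rewrite ler0q.
lra.
Qed.

Lemma scale_contractive F gamma :
  contractive_scale (@delta_betaN R) (scale F gamma).
Proof.
split; last exact: scale_separated.
- rewrite -subTset => p _.
  exists (Num.truncn gamma).+1%:R => //.
  rewrite /scale ltNge ler0n /= ratr_nat truncnS_gt//.
- by rewrite -subset0 => p /(_ (-1) I); rewrite /scale ltrN10.
Qed.

(** * Normality *)

Lemma normal_distance_betaN : normal_distance (@delta_betaN R).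
Proof.
move=> A B gamma gamma0 AB.
have [k kgamma kmax] : exists2 k : nat,
    k%:R < gamma & forall j : nat, j%:R < gamma -> (j <= k)%N.
  have ex : exists k : nat, k%:R < gamma by exists 0%N.
  have ub (j : nat) : j%:R < gamma -> (j <= Num.truncn gamma)%N.
    by move=> /ltW; rewrite truncn_ge_nat// ltW.
  by case: (ex_maxnP ex ub) => k; exists k.
have [F [G [AF BG FG0]]] : exists F G,
    [/\ filter_of A F, filter_of B G & thicken F k `&` G = set0].
  by apply: disjoint_sets_of_separated; apply: AB => //; rewrite addr0.
exists (scale F gamma); split.
- exact: scale_contractive.
- by move=> q q0; rewrite /scale q0.
- move=> p Ap q /= q0; rewrite /scale ltNge q0 /=; case: ifP => // _.
  apply: filterS (AF _ Ap) => m Fm; exists 0%N; first by left.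
  exact: thicken_id.
- rewrite -subset0 => p [Bp [q [/= q0 qg]]].
  rewrite /scale ltNge (ltW q0) /= ltNge qg /= => pF.
  have [m [Gm [j jq Fm]]] := filter_ex (filterI (BG _ Bp) pF).
  have : (thicken F k `&` G) m; last by rewrite FG0.
  split=> //; apply: thickenS Fm; apply: kmax.
  by case: jq => [->//|/lt_le_trans]; apply.
Qed.

End Distances.

Theorem proposition8p1 (R : realType) :
  normal_approach_space (@delta_betaN R).
Proof. by split; [exact: is_distance_betaN|exact: normal_distance_betaN]. Qed.
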